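(* Let $T^{\pm}$ be a Lorenz map with critical point $q$ and let $\epsilon\in(0,1)$. Consider the following procedure, run with exact (infinite precision) arithmetic. (1) Compute $\alpha:=\tau_q^-(q)$ and $\beta:=\tau_q^+(q)$. (2) Initialise $a_1=1$, $a_2=2$. (3) Set $a=(a_1+a_2)/2$. (4) If $\alpha\ne0\overline1$ and $\beta\neq1\overline0$, go to (5). Otherwise: (a) if $\alpha=0\overline1$ and $\beta\ne1\overline0$, compute $\mu^+_{a,a^{-1}}(a^{-1})$ and go to (11); (b) else compute $\mu^-_{a,1-a^{-1}}(1-a^{-1})$ and go to (12). (5) Compute $\pi_a(\alpha)$ and $\pi_a(\beta)$. (6) Compute $t_1(a):=\max\{\pi_a(\alpha),1-a^{-1}\}$ and $t_2(a):=\min\{\pi_a(\beta),a^{-1}\}$. (7) If $t_1(a)\ge t_2(a)$, set $a_1\leftarrow a$ and go to (13); else go to (8). (8) Set $p=(t_1(a)+t_2(a))/2$. (9) Compute $\mu_{a,p}^+(p)$ and $\mu_{a,p}^-(p)$. (10) If $\alpha\prec\mu_{a,p}^-(p)$ and $\mu_{a,p}^+(p)\prec\beta$, set $a_2\leftarrow a$; else set $a_1\leftarrow a$. Go to (13). (11) If $\mu^+_{a,a^{-1}}(a^{-1})\prec\beta$, set $a_2\leftarrow a$; else set $a_1\leftarrow a$. Go to (13). (12) If $\alpha\prec\mu^-_{a,1-a^{-1}}(1-a^{-1})$, set $a_2\leftarrow a$; else set $a_1\leftarrow a$. Go to (13). (13) If $a_2-a_1<\epsilon/2$, return the interval $[\ln((a_1+a_2)/2-\epsilon/4),\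 \ln((a_1+a_2)/2+\epsilon/4)]$ and terminate; else go to (3). Then the inequalities $\ln(a_1)\le h(T)\le\ln(a_2)$ hold throughout the procedure, the procedure terminates, and the returned interval contains $h(T)$; thus it estimates $h(T)$ within tolerance $\epsilon$.
   Context: Lorenz maps: let $q\in(0,1)$ and let $f_0:[0,q]\to[0,1]$, $f_1:[q,1]\to[0,1]$ be continuous strictly increasing functions with $f_0(0)=0$, $f_1(1)=1$ and either $1>f_0(q)>f_1(q)\ge 0$ or $1\ge f_0(q)>f_1(q)>0$, such that there is $s>1$ with $|f_i(x)-f_i(y)|\ge s|x-y|$ for $i\in\{0,1\}$ and all $x,y$ in the domain of $f_i$. The upper Lorenz map $T^+:[0,1]\to[0,1]$ with critical point $q$ equals $f_0$ on $[0,q)$ and $f_1$ on $[q,1]$; the lower Lorenz map $T^-$ equals $f_0$ on $[0,q]$ and $f_1$ on $(q,1]$. ''Lorenz map $T^\pm$'' means both $T^+$ and $T^-$, built from the same $f_0,f_1$. Itineraries: $\Omega=\{0,1\}^{\infty}$ is the set of infinite strings $\omega_0\omega_1\omega_2\cdots$ over $\{0,1\}$ with the lexicographic order $\prec,\preceq$; $0\overline1=0111\cdots$ and $1\overline0=1000\cdots$. For $x\in[0,1]$, $\tau_q^+(x)=\omega_0\omega_1\cdots$ with $\omega_k=0$ if $(T^+)^k(x)<q$ and $\omega_k=1$ if $(T^+)^k(x)\ge q$; $\tau_q^-(x)=\sigma_0\sigma_1\cdots$ with $\sigma_k=0$ if $(T^-)^k(x)\le q$ and $\sigma_k=1$ if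 $(T^-)^k(x)>q$. The address spaces are $\Omega_q^\pm:=\tau_q^\pm([0,1])$. Entropy: $h(T^\pm):=\lim_{n\to\infty}\frac1n\ln|\Omega_{q,n}^\pm|$, where $\Omega_{q,n}^\pm$ is the set of length-$n$ prefixes of elements of $\Omega_q^\pm$. It is known that $h(T^+)=h(T^-)\le\ln 2$; the common value is denoted $h(T)$. Uniform Lorenz maps: $(a,p)$ is admissible if $a\in(1,2)$, $p\in(0,1)$ and $1-a^{-1}\le p\le a^{-1}$. For admissible $(a,p)$, $U_{a,p}^+(x)=ax$ for $0\le x<p$ and $ax+1-a$ for $p\le x\le1$; $U_{a,p}^-(x)=ax$ for $0\le x\le p$ and $ax+1-a$ for $p<x\le 1$. These are Lorenz maps with critical point $p$; their itinerary maps are denoted $\mu_{a,p}^\pm$. Coding map: for $a\in(1,2)$, $\pi_a:\Omega\to[0,1]$, $\pi_a(\omega_0\omega_1\cdots)=(1-a^{-1})\sum_{k\ge0}\omega_k a^{-k}$. *)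

(* Defs.v *)
From HB Require Import structures.
From mathcomp Require Import all_boot all_order all_algebra.
From mathcomp Require Import all_classical all_reals all_analysis.

Set Implicit Arguments.
Unset Strict Implicit.
Unset Printing Implicit Defensive.

Import Order.TTheory GRing.Theory Num.Theory.
Import numFieldNormedType.Exports.

Local Open Scope classical_set_scope.
Local Open Scope ring_scope.

(* Infinite binary strings; the digits 0 and 1 are [false] and [true]. *)
Definition word := nat -> bool.

Definition word_lt (u v : word) : Prop :=
  exists n, (forall k, (k < n)%N -> u k = v k) /\ u n = false /\ v n = true.

(* 0111... and 1000... *)
Definition word01 : word := fun k => (0 < k)%N.
Definition word10 : word := fun k => k == 0%N.

(* Branches are total functions on [R], of which only the restrictions of [f0]
   to [0, q] and of [f1] to [q, 1] are constrained, and only these matter for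
   the orbits of points of [0, 1]. *)
Record lorenz (R : realType) (q : R) (f0 f1 : R -> R) : Prop := Lorenz {
  lorenz_crit : 0 < q < 1;
  lorenz_range0 : forall x, x \in `[0, q] -> f0 x \in `[0, 1];
  lorenz_range1 : forall x, x \in `[q, 1] -> f1 x \in `[0, 1];
  lorenz_cont0 : {within `[0, q], continuous f0};
  lorenz_cont1 : {within `[q, 1], continuous f1};
  lorenz_incr0 : {in `[0, q] &, {homo f0 : x y / x < y}};
  lorenz_incr1 : {in `[q, 1] &, {homo f1 : x y / x < y}};
  lorenz_fix0 : f0 0 = 0;
  lorenz_fix1 : f1 1 = 1;
  lorenz_jump : (f1 q < f0 q < 1 /\ 0 <= f1 q) \/ (0 < f1 q < f0 q /\ f0 q <= 1);
  lorenz_expand : exists s, [/\ 1 < s,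
    {in `[0, q] &, forall x y, s * `|x - y| <= `|f0 x - f0 y|} &
    {in `[q, 1] &, forall x y, s * `|x - y| <= `|f1 x - f1 y|}] }.

(* [Upper] and [Lower] are the superscripts + and -. *)
Variant side := Upper | Lower.

(* Whether [x] is coded by the digit 1. *)
Definition right_of (R : realType) (s : side) (q x : R) : bool :=
  if s is Upper then q <= x else q < x.

Definition lorenz_map (R : realType) (s : side) (q : R) (f0 f1 : R -> R)
    (x : R) : R :=
  if right_of s q x then f1 x else f0 x.

Definition itinerary (R : realType) (s : side) (q : R) (f0 f1 : R -> R)
    (x : R) : word :=
  fun k => right_of s q (iter k (lorenz_map s q f0 f1) x).

Definition address_space (R : realType) (s : side) (q : R) (f0 f1 : R -> R) :
    set word :=
  itinerary s q f0 f1 @` `[0, 1].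

Definition nprefixes (A : set word) (n : nat) : nat :=
  #|[pred t : n.-tuple bool | `[< exists2 w, A w & t = [tuple w i | i < n] >]]|.

Definition entropy (R : realType) (s : side) (q : R) (f0 f1 : R -> R) : R :=
  limn (fun n => n%:R^-1 * ln (nprefixes (address_space s q f0 f1) n)%:R).

(* The itinerary of [x] under the uniform Lorenz map with slope [a] and
   critical point [p]. *)
Definition uniform_itinerary (R : realType) (s : side) (a p x : R) : word :=
  itinerary s p (fun y => a * y) (fun y => a * y + 1 - a) x.

Definition coding (R : realType) (a : R) (w : word) : R :=
  (1 - a^-1) * limn (series (fun k => (w k)%:R * a ^- k)).

(* One pass of the bisection loop, acting on [(a1, a2)]. *)
Definition bisect (R : realType) (alpha beta : word) (a12 : R * R) : R * R :=
  let: (a1, a2) := a12 in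
  let a := (a1 + a2) / 2 in
  if `[< alpha <> word01 /\ beta <> word10 >] then
    let t1 := Num.max (coding a alpha) (1 - a^-1) in
    let t2 := Num.min (coding a beta) a^-1 in
    if t1 >= t2 then (a, a2) else
    let p := (t1 + t2) / 2 in
    if `[< word_lt alpha (uniform_itinerary Lower a p p) /\
           word_lt (uniform_itinerary Upper a p p) beta >]
    then (a1, a) else (a, a2)
  else if `[< alpha = word01 /\ beta <> word10 >] then
    if `[< word_lt (uniform_itinerary Upper a a^-1 a^-1) beta >]
    then (a1, a) else (a, a2)
  else
    if `[< word_lt alpha (uniform_itinerary Lower a (1 - a^-1) (1 - a^-1)) >]
    then (a1, a) else (a, a2).

(* The value of [(a1, a2)] after [n] passes, disregarding the stopping test. *)
Definition bounds (R : realType) (alpha beta : word) (n : nat) : R * R :=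
  iter n (bisect alpha beta) (1, 2).

Definition stop_test (R : realType) (eps : R) (a12 : R * R) : bool :=
  a12.2 - a12.1 < eps / 2.

(* The procedure terminates after exactly [N] passes; the stopping test is
   evaluated at the end of each pass, so [N] is positive. *)
Definition terminates_after (R : realType) (alpha beta : word) (eps : R)
    (N : nat) : Prop :=
  [/\ (0 < N)%N, stop_test eps (bounds R alpha beta N) &
      forall n, (0 < n < N)%N -> ~~ stop_test eps (bounds R alpha beta n)].

Definition returned (R : realType) (eps : R) (a12 : R * R) : interval R :=
  let m := (a12.1 + a12.2) / 2 in `[ln (m - eps / 4), ln (m + eps / 4)].

(* Main.v *)
(** Let c(n) be the number of laps of the n-th iterate of T, which is the number
    of length-n prefixes of addresses, and let pi_a be the coding map.

    Lower bound.  Consecutive laps are separated by a preimage of q of some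
    order j, across which the truncated coding jumps by about
    a^-j (pi_a(beta) - pi_a(alpha)).  If this jump is not positive then summing
    over the laps, the coding going from 0 to 1, gives c(n) >= a^n.  If it is
    positive and c(m) < a^m for some m, the same summation shows that pi_a is
    monotone on addresses; then for every p in [pi_a(alpha), pi_a(beta)] the
    points pi_a(alpha) and pi_a(beta) follow the codes alpha and beta under the
    uniform map U_{a,p}, and comparing them with p gives alpha < mu^-(p) if
    pi_a(alpha) < p, and mu^+(p) < beta if p < pi_a(beta).  So when a test of
    the procedure fails, h(T) >= ln a.

    Upper bound.  If alpha <= mu^-(p) and mu^+(p) <= beta, every address of T
    satisfies the kneading constraints of U_{a,p}, so c(n) is at most the number
    of laps of U_{a,p}^n.  Short intervals meet at most two laps of U^K for a
    fixed K with a^K > 2, and iterating this bound gives growth rate a.  So when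
    a test succeeds, h(T) <= ln a. *)

Require Import Defs.
From mathcomp Require Import all_boot all_order all_algebra.
From mathcomp Require Import all_classical all_reals all_analysis.
From mathcomp Require Import ring lra.

Set Implicit Arguments.
Unset Strict Implicit.
Unset Printing Implicit Defensive.

Import Order.TTheory GRing.Theory Num.Theory.
Import numFieldNormedType.Exports.

Local Open Scope classical_set_scope.
Local Open Scope ring_scope.

(** * Lexicographic order on binary words *)

Definition word_le (u v : word) : Prop :=
  forall n, (forall k, (k < n)%N -> u k = v k) -> u n -> v n.

Definition word_shift (n : nat) (w : word) : word := fun k => w (n + k)%N.

Lemma shift0 w : word_shift 0 w = w.
Proof. by []. Qed.

Lemma shift_shift m n w : word_shift m (word_shift n w) = word_shift (n + m) w.
Proof. by apply/funext => k; rewrite /word_shift addnA. Qed.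

Lemma eq_word_or_first_diff (u v : word) :
  u = v \/ exists n, (forall k, (k < n)%N -> u k = v k) /\ u n <> v n.
Proof.
have [euv|/existsNP [m neq_m]] := pselect (forall n, u n = v n).
  by left; apply/funext.
have /ex_minnP [n /eqP neq_n min_n] : exists n, u n != v n.
  by exists m; apply/eqP.
right; exists n; split=> // k lt_kn; apply/eqP; apply: contraTT lt_kn.
by rewrite -leqNgt; apply: min_n.
Qed.

Lemma word_ltW u v : word_lt u v -> word_le u v.
Proof.
move=> [n [euv [un vn]]] m euvm um.
have [lt_mn|lt_nm|->] := ltngtP m n; first by rewrite -euv.
  by rewrite euvm // vn in un.
by rewrite vn.
Qed.

(** [word_le] asks for one implication per index, which suits induction on the index; reading it at
    the first difference recovers the usual dichotomy. *)
Lemma word_leP u v : word_le u v -> u = v \/ word_lt u v.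
Proof.
move=> leuv; have [->|[n [euv neq]]] := eq_word_or_first_diff u v; [by left|right].
exists n; split=> //; have := leuv n euv.
by case: (u n) (v n) neq => [] [] // _ /(_ isT).
Qed.

Lemma word_le_trans v u w : word_le u v -> word_le v w -> word_le u w.
Proof.
move=> /word_leP [-> //|[m [euv [um vm]]]] /word_leP [<-|].
  by apply: word_ltW; exists m.
move=> [n [evw [vn wn]]]; apply: word_ltW.
have [lt_mn|lt_nm|eq_mn] := ltngtP m n.
- exists m; split; last by rewrite -evw.
  by move=> k lt_km; rewrite euv ?evw //; apply: ltn_trans lt_mn.
- exists n; split; last by rewrite euv.
  by move=> k lt_kn; rewrite euv ?evw //; apply: ltn_trans lt_nm.
by rewrite eq_mn vn in vm.
Qed.

Lemma word_le_shift u v : word_le u v -> u 0%N = v 0%N ->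
  word_le (word_shift 1 u) (word_shift 1 v).
Proof.
move=> leuv e0 n en; apply: (leuv n.+1) => -[|k] // lt_kn.
exact: en.
Qed.

Lemma word_le0 u v : word_le u v -> u 0%N -> v 0%N.
Proof. by move=> leuv; apply: leuv. Qed.

Lemma shift1_const (b : bool) w :
  (forall n, word_shift 1 w n = b) -> w 0%N = ~~ b ->
  w = if b then word01 else word10.
Proof.
move=> w1 w0; apply/funext => -[|n]; first by rewrite w0; case: b {w1 w0}.
by rewrite -[w n.+1]/(word_shift 1 w n) w1; case: b {w1 w0}.
Qed.

(** * The coding map and its truncations *)

Section Coding.
Variables (R : realType) (a : R).
Hypothesis a_gt1 : 1 < a.

Let a_gt0 : 0 < a. Proof. exact: lt_trans a_gt1. Qed.
Let ia_gt0 : 0 < a^-1. Proof. by rewrite invr_gt0. Qed.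
Let ia_lt1 : a^-1 < 1. Proof. by rewrite invf_lt1. Qed.

Let term (w : word) (k : nat) : R := (w k)%:R * a ^- k.

Let term_ge0 w k : 0 <= term w k.
Proof. by rewrite mulr_ge0 // invr_ge0 exprn_ge0 // ltW. Qed.

Let term_le w k : term w k <= geometric 1 a^-1 k.
Proof.
rewrite /= mul1r exprVn ler_piMl ?invr_ge0 ?exprn_ge0 ?(ltW a_gt0) //.
by rewrite lern1 leq_b1.
Qed.

Let cvg_geom : series (geometric 1 a^-1) @ \oo --> (1 - a^-1)^-1.
Proof.
by rewrite -[X in _ --> X]mul1r; apply: cvg_geometric_series; rewrite gtr0_norm.
Qed.

Let cvg_term w : cvgn (series (term w)).
Proof.
apply: (@series_le_cvg _ _ (geometric 1 a^-1)) (term_ge0 w) _ (term_le w) _.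
  by move=> k; rewrite /= mul1r exprn_ge0 // ltW.
exact: cvgP cvg_geom.
Qed.

Lemma coding_ge0 w : 0 <= coding a w.
Proof.
rewrite mulr_ge0 ?subr_ge0 ?(ltW ia_lt1) //.
apply: limr_ge; first exact: cvg_term.
by apply: nearW => n; apply: sumr_ge0 => k _; apply: term_ge0.
Qed.

Lemma coding_le1 w : coding a w <= 1.
Proof.
rewrite /coding mulrC -ler_pdivlMr ?subr_gt0 // mul1r -(cvg_lim (@Rhausdorff R) cvg_geom).
by apply: lim_series_le (term_le w); [exact: cvg_term | exact: cvgP cvg_geom].
Qed.

Lemma coding_rec w :
  coding a w = (1 - a^-1) * (w 0%N)%:R + a^-1 * coding a (word_shift 1 w).
Proof.
rewrite /coding mulrCA -mulrDr; congr (_ * _).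
apply: (cvg_lim (@Rhausdorff R)).
rewrite -cvg_shiftS [X in X @ \oo --> _](_ : _ =
  (fun n => (w 0%N)%:R + a^-1 * series (term (word_shift 1 w)) n)); last first.
  apply/funext => n; rewrite /series /= big_nat_recl // /term expr0 invr1 mulr1.
  by congr (_ + _); rewrite big_distrr; apply: eq_bigr => k _; rewrite exprS invfM mulrCA.
apply: cvgD; first exact: cvg_cst.
by apply: cvgMl_tmp; exact: cvg_term.
Qed.

(** Shifting acts on codings by an affine branch of the uniform map of slope [a]: y goes to a y
    after the digit 0 and to a y + 1 - a after the digit 1. *)
Lemma coding_shift k w :
  coding a (word_shift k.+1 w) =
  a * coding a (word_shift k w) + (w k)%:R * (1 - a).
Proof.
rewrite [coding a (word_shift k w)]coding_rec shift_shift addn1 mulrDr mulVKf ?gt_eqF //.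
by rewrite /word_shift addn0; field; rewrite gt_eqF.
Qed.

(** A leading 0 would give a value of at most a^-1 < 1; after a leading 1 the tail again has value
    at least 1. *)
Lemma coding_ge1 w : 1 <= coding a w -> forall n, w n.
Proof.
move=> le1 n; elim: n w le1 => [|n IHn] w; rewrite coding_rec; have := coding_le1 (word_shift 1 w).
  case: (w 0%N) => // le1; rewrite mulr0 add0r => ge1.
  suff: (1 : R) < 1 by rewrite ltxx.
  apply: le_lt_trans ge1 _; apply: le_lt_trans ia_lt1.
  by rewrite ler_piMr // ltW.
move=> le1 ge1; apply: (IHn (word_shift 1 w)).
rewrite -(ler_pM2l ia_gt0) mulr1 -(lerD2l (1 - a^-1)) subrK; apply: le_trans ge1 _.
by rewrite lerD2r ler_piMr ?subr_ge0 ?(ltW ia_lt1) // lern1 leq_b1.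
Qed.

Lemma coding_le0 w : coding a w <= 0 -> forall n, w n = false.
Proof.
move=> le0 n; elim: n w le0 => [|n IHn] w; rewrite coding_rec; have := coding_ge0 (word_shift 1 w).
  case: (w 0%N) => // ge0; rewrite mulr1 => le0.
  have := mulr_ge0 (ltW ia_gt0) ge0; have := ia_lt1; lra.
move=> ge0 le0; apply: (IHn (word_shift 1 w)).
rewrite -(ler_pM2l ia_gt0) mulr0; apply: le_trans le0.
by rewrite lerDr mulr_ge0 // subr_ge0 ltW.
Qed.

Lemma coding_const (b : bool) : coding a (fun=> b) = b%:R.
Proof.
have := coding_rec (fun=> b); rewrite (_ : word_shift 1 _ = (fun=> b)) //.
move=> /eqP; rewrite -subr_eq0 => /eqP H.
apply/eqP; rewrite -subr_eq0; apply/eqP.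
have n0 : 1 - a^-1 != 0 by rewrite gt_eqF ?subr_gt0.
by apply: (mulfI n0); rewrite mulr0 -H; ring.
Qed.

Lemma coding_word01 : coding a word01 = a^-1.
Proof.
rewrite coding_rec mulr0 add0r (_ : word_shift 1 _ = (fun=> true)).
  by rewrite coding_const mulr1.
exact/funext.
Qed.

Lemma coding_word10 : coding a word10 = 1 - a^-1.
Proof.
rewrite coding_rec mulr1 (_ : word_shift 1 _ = (fun=> false)).
  by rewrite coding_const mulr0 addr0.
exact/funext.
Qed.

(** A partial sum of the coding series, written by recursion on the leading digit so that it unfolds
    in step with [laps]. *)
Fixpoint coding_trunc (n : nat) (w : word) : R :=
  if n is m.+1 then (1 - a^-1) * (w 0%N)%:R + a^-1 * coding_trunc m (word_shift 1 w)
  else 0.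

Lemma coding_trunc_bounds n w :
  coding_trunc n w <= coding a w <= coding_trunc n w + a ^- n.
Proof.
elim: n w => [|n IHn] w /=.
  by rewrite coding_ge0 add0r expr0 invr1 coding_le1.
have /andP[lb ub] := IHn (word_shift 1 w).
rewrite coding_rec lerD2l -addrA lerD2l exprS invfM -mulrDr.
by rewrite !ler_pM2l ?lb.
Qed.

Lemma coding_trunc1 n : coding_trunc n (fun=> true) = 1 - a ^- n.
Proof.
elim: n => [|n IHn] /=; first by rewrite expr0 invr1 subrr.
by rewrite (_ : word_shift 1 _ = (fun=> true)) // IHn exprS invfM; ring.
Qed.

Lemma coding_trunc0 n : coding_trunc n (fun=> false) = 0.
Proof.
elim: n => [|n IHn] //=.
by rewrite (_ : word_shift 1 _ = (fun=> false)) // IHn !mulr0 addr0.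
Qed.

(** The tail must have value 1, hence consist of ones. Outside the exceptional cases of the
    procedure this keeps the coding of alpha below a^-1. *)
Lemma coding_word01_eq (w : word) : w 0%N = false -> a^-1 <= coding a w -> w = word01.
Proof.
move=> w0; rewrite coding_rec w0 mulr0 add0r -{1}[a^-1]mulr1 ler_pM2l // => ge1.
by apply: (@shift1_const true) => // n; apply: coding_ge1.
Qed.

Lemma coding_word10_eq (w : word) : w 0%N -> coding a w <= 1 - a^-1 -> w = word10.
Proof.
move=> w0; rewrite coding_rec w0 mulr1 -{2}[1 - a^-1]addr0 lerD2l.
rewrite pmulr_rle0 // => le0.
by apply: (@shift1_const false) => // n; apply: coding_le0.
Qed.

End Coding.

Lemma mkseqS_shift (w : word) n : mkseq w n.+1 = w 0%N :: mkseq (word_shift 1 w) n.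
Proof. by rewrite /mkseq /= (iotaDl 1 0 n) -map_comp. Qed.

(** * Itineraries and laps of iterates *)

Section Itineraries.
Variables (R : realType) (q : R) (f0 f1 : R -> R).

Local Notation T s := (lorenz_map s q f0 f1).
Local Notation tau s := (itinerary s q f0 f1).

Lemma shift_itinerary s k x : word_shift k (tau s x) = tau s (iter k (T s) x).
Proof. by apply/funext => j; rewrite /word_shift /itinerary addnC iterD. Qed.

Lemma shift1_itinerary s x :
  word_shift 1 (tau s x) = tau s (if right_of s q x then f1 x else f0 x).
Proof. exact: shift_itinerary. Qed.

Lemma right_of_gt s x : q < x -> right_of s q x.
Proof. by case: s => //= /ltW. Qed.

Lemma right_of_lt s x : x < q -> right_of s q x = false.
Proof. by case: s => /= xq; [exact: lt_geF | exact/le_gtF/ltW]. Qed.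

Lemma right_of_le s x : right_of s q x = false -> x <= q.
Proof. by case: s => /= /negbT; rewrite -?ltNge -?leNgt // => /ltW. Qed.

Lemma right_of_ge s x : right_of s q x -> q <= x.
Proof. by case: s => //= /ltW. Qed.

Lemma shift1_itinerary_gt s x : q < x -> word_shift 1 (tau s x) = tau s (f1 x).
Proof. by move=> qx; rewrite shift1_itinerary right_of_gt. Qed.

Lemma shift1_itinerary_lt s x : x < q -> word_shift 1 (tau s x) = tau s (f0 x).
Proof. by move=> qx; rewrite shift1_itinerary right_of_lt. Qed.

Lemma shift1_itinerary_lower x : x <= q ->
  word_shift 1 (tau Lower x) = tau Lower (f0 x).
Proof. by move=> xq; rewrite shift1_itinerary /= le_gtF. Qed.

Lemma shift1_itinerary_upper x : q <= x ->
  word_shift 1 (tau Upper x) = tau Upper (f1 x).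
Proof. by move=> xq; rewrite shift1_itinerary /= xq. Qed.

(* The length-[n] itineraries of the open interval (x, y), listed lap by lap of
   the [n]-th iterate. *)
Fixpoint laps (n : nat) (x y : R) : seq (seq bool) :=
  if n is m.+1 then
    if y <= q then map (cons false) (laps m (f0 x) (f0 y))
    else if q <= x then map (cons true) (laps m (f1 x) (f1 y))
    else map (cons false) (laps m (f0 x) (f0 q)) ++
         map (cons true) (laps m (f1 q) (f1 y))
  else [:: [::]].

Lemma uniq_laps n x y : uniq (laps n x y).
Proof.
have inj b : injective (@cons bool b) by move=> u v [].
elim: n x y => [|n IHn] x y //=.
case: ifP => _; first by rewrite map_inj_uniq.
case: ifP => _; first by rewrite map_inj_uniq.
rewrite cat_uniq !map_inj_uniq // !IHn andbT /=.
by apply/hasPn => _ /mapP[u _ ->]; apply/mapP => -[].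
Qed.

Lemma size_laps_le n x y : (size (laps n x y) <= 2 ^ n)%N.
Proof.
elim: n x y => [|n IHn] x y //=; rewrite expnS mul2n -addnn.
by do 2?[case: ifP => _]; rewrite ?size_cat !size_map ?leq_add // (leq_trans (IHn _ _)) // leq_addr.
Qed.

Definition kneading_word (w : word) : Prop := forall k,
  if w k then word_le (tau Upper q) (word_shift k w)
  else word_le (word_shift k w) (tau Lower q).

Lemma kneading_word_shift1 w : kneading_word w -> kneading_word (word_shift 1 w).
Proof. by move=> adm k; rewrite shift_shift; exact: adm. Qed.

(** A word squeezed between the itineraries of the endpoints stays squeezed when the leading digit
    is removed and the interval is mapped by the matching branch. Monotonicity on the whole line
    fits the affine branches to which this is applied. *)
Lemma kneading_word_laps n x y w :
  {homo f0 : u v / u < v} -> {homo f1 : u v / u < v} ->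
  x < y -> kneading_word w ->
  word_le (tau Upper x) w -> word_le w (tau Lower y) ->
  mkseq w n \in laps n x y.
Proof.
move=> f0_lt f1_lt; elim: n x y w => [|n IHn] x y w lt_xy adm le_xw le_wy //.
have consE b : mkseq w n.+1 = w 0%N :: mkseq (word_shift 1 w) n by exact: mkseqS_shift.
have adm1 := kneading_word_shift1 adm.
have inj b : injective (@cons bool b) by move=> u v [].
have case0 t : x < t -> t <= q -> word_le w (tau Lower t) ->
    w 0%N = false /\ mkseq (word_shift 1 w) n \in laps n (f0 x) (f0 t).
  move=> lt_xt le_tq le_wt.
  have w0 : w 0%N = false.
    by apply/negP => /(word_le0 le_wt); rewrite /itinerary /= ltNge le_tq.
  have lt_xq := lt_le_trans lt_xt le_tq.
  split=> //; apply: IHn => //; first exact: f0_lt.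
    rewrite -(@shift1_itinerary_lt Upper) //; apply: word_le_shift => //.
    by rewrite w0; apply: (@right_of_lt Upper).
  rewrite -(@shift1_itinerary_lower) //; apply: word_le_shift => //.
  by rewrite w0; apply/esym/negbTE; rewrite -leNgt.
have case1 t : t < y -> q <= t -> word_le (tau Upper t) w ->
    w 0%N = true /\ mkseq (word_shift 1 w) n \in laps n (f1 t) (f1 y).
  move=> lt_ty le_qt le_tw.
  have w0 : w 0%N = true by apply: (word_le0 le_tw).
  have lt_qy := le_lt_trans le_qt lt_ty.
  split=> //; apply: IHn => //; first exact: f1_lt.
    by rewrite -(@shift1_itinerary_upper) //; apply: word_le_shift => //; rewrite w0.
  rewrite -(@shift1_itinerary_gt Lower) //; apply: word_le_shift => //.
  by rewrite w0 /itinerary /= lt_qy.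
rewrite mkseqS_shift /=; case: leP => [le_yq|lt_qy].
  by have [-> mem] := case0 y lt_xy le_yq le_wy; rewrite mem_map.
case: leP => [le_qx|lt_xq].
  by have [-> mem] := case1 x lt_xy le_qx le_xw; rewrite mem_map.
(* When [q] is interior, the kneading constraint at index 0 supplies the missing bound at the new
   endpoint [q]. *)
rewrite mem_cat; have := adm 0%N; rewrite shift0.
case w0: (w 0%N).
  move=> le_qw; have [_ mem] := case1 q lt_qy (lexx q) le_qw.
  by rewrite mem_map ?mem ?orbT.
move=> le_wq; have [_ mem] := case0 q lt_xq (lexx q) le_wq.
by rewrite mem_map ?mem.
Qed.

Section Lorenz.
Hypothesis L : lorenz q f0 f1.

Lemma lorenz_q_gt0 : 0 < q. Proof. by case/andP: (lorenz_crit L). Qed.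
Lemma lorenz_q_lt1 : q < 1. Proof. by case/andP: (lorenz_crit L). Qed.

Lemma lorenz_lt0 x y : 0 <= x -> x < y -> y <= q -> f0 x < f0 y.
Proof.
move=> x_ge0 lt_xy le_yq; apply: (lorenz_incr0 L) => //; rewrite in_itv /=.
  by rewrite x_ge0 (le_trans (ltW lt_xy)).
by rewrite le_yq (le_trans _ (ltW lt_xy)).
Qed.

Lemma lorenz_lt1 x y : q <= x -> x < y -> y <= 1 -> f1 x < f1 y.
Proof.
move=> x_ge0 lt_xy le_yq; apply: (lorenz_incr1 L) => //; rewrite in_itv /=.
  by rewrite x_ge0 (le_trans (ltW lt_xy)).
by rewrite le_yq (le_trans _ (ltW lt_xy)).
Qed.

Lemma lorenz_itv0 x : 0 <= x -> x <= q -> 0 <= f0 x <= 1.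
Proof. by move=> x0 xq; have := @lorenz_range0 _ _ _ _ L x; rewrite !in_itv /= x0 xq; apply. Qed.

Lemma lorenz_itv1 x : q <= x -> x <= 1 -> 0 <= f1 x <= 1.
Proof. by move=> x0 xq; have := @lorenz_range1 _ _ _ _ L x; rewrite !in_itv /= x0 xq; apply. Qed.

Lemma lorenz_map_itv s x : 0 <= x <= 1 -> 0 <= T s x <= 1.
Proof.
move=> /andP[x0 x1]; rewrite /lorenz_map.
case E: (right_of s q x); first exact: lorenz_itv1 (right_of_ge E) _.
exact: lorenz_itv0 (right_of_le E).
Qed.

Lemma lorenz_iter_itv s k x : 0 <= x <= 1 -> 0 <= iter k (T s) x <= 1.
Proof. by move=> x01; elim: k => //= k; apply: lorenz_map_itv. Qed.

Lemma lorenz_ivt0 x y v : 0 <= x -> x < y -> y <= q -> f0 x < v < f0 y ->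
  exists2 z, x < z < y & f0 z = v.
Proof.
move=> x0 lt_xy yq /andP[xv vy].
have cont : {within `[x, y], continuous f0}.
  apply: continuous_subspaceW (lorenz_cont0 L) => z /=; rewrite !in_itv /=.
  by move=> /andP[xz zy]; rewrite (le_trans x0 xz) (le_trans zy yq).
have lt_f := lt_trans xv vy.
have [|z] := IVT (ltW lt_xy) cont (v := v).
  by rewrite min_l ?max_r ?(ltW xv) ?(ltW vy) // ltW.
rewrite in_itv /= => /andP[xz zy] fz; exists z => //.
by rewrite !lt_neqAle xz zy !andbT; apply/andP; split; apply/eqP => E;
  move: xv vy; rewrite -fz E ltxx.
Qed.

Lemma lorenz_ivt1 x y v : q <= x -> x < y -> y <= 1 -> f1 x < v < f1 y ->
  exists2 z, x < z < y & f1 z = v.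
Proof.
move=> x0 lt_xy yq /andP[xv vy].
have cont : {within `[x, y], continuous f1}.
  apply: continuous_subspaceW (lorenz_cont1 L) => z /=; rewrite !in_itv /=.
  by move=> /andP[xz zy]; rewrite (le_trans x0 xz) (le_trans zy yq).
have lt_f := lt_trans xv vy.
have [|z] := IVT (ltW lt_xy) cont (v := v).
  by rewrite min_l ?max_r ?(ltW xv) ?(ltW vy) // ltW.
rewrite in_itv /= => /andP[xz zy] fz; exists z => //.
by rewrite !lt_neqAle xz zy !andbT; apply/andP; split; apply/eqP => E;
  move: xv vy; rewrite -fz E ltxx.
Qed.

(** Equal leading digits put both points on one branch, which preserves x < y. As this inequality is
    strict, the two sides may differ. *)
Lemma itinerary_homo s s' x y : 0 <= x -> x < y -> y <= 1 ->
  word_le (tau s x) (tau s' y).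
Proof.
move=> + + + n; elim: n x y => [|n IHn] x y x0 lt_xy y1 eq_xy.
  by move=> /right_of_ge le_qx; apply: right_of_gt; apply: le_lt_trans lt_xy.
have := eq_xy 0%N isT; rewrite -[tau s x n.+1]/(word_shift 1 (tau s x) n).
rewrite -[tau s' y n.+1]/(word_shift 1 (tau s' y) n) !shift1_itinerary.
rewrite {1 2}/itinerary /= => E.
have eq_xy1 k : (k < n)%N -> word_shift 1 (tau s x) k = word_shift 1 (tau s' y) k.
  by move=> lt_kn; apply: (eq_xy k.+1).
rewrite !shift1_itinerary in eq_xy1.
case Ex: (right_of s q x) E eq_xy1 => Ey; rewrite -Ey => eq_xy1.
  have := right_of_ge Ex => qx; apply: IHn => //.
  - by case/andP: (lorenz_itv1 qx (le_trans (ltW lt_xy) y1)).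
  - exact: lorenz_lt1.
  - by case/andP: (lorenz_itv1 (le_trans qx (ltW lt_xy)) y1).
have yq := right_of_le (esym Ey); apply: IHn => //.
- by case/andP: (lorenz_itv0 x0 (le_trans (ltW lt_xy) yq)).
- exact: lorenz_lt0.
- by case/andP: (lorenz_itv0 (le_trans x0 (ltW lt_xy)) yq).
Qed.

(** A witness is pulled back through the branches by the intermediate value theorem. It stays in
    open intervals that avoid [q], so either side gives the same digit. *)
Lemma lapsP s n x y t : 0 <= x -> x < y -> y <= 1 -> t \in laps n x y ->
  exists2 z, x < z < y & t = mkseq (tau s z) n.
Proof.
elim: n x y t => [|n IHn] x y t x0 lt_xy y1 /=.
  rewrite inE => /eqP ->; exists ((x + y) / 2) => //.
  by rewrite midf_lt // midf_lt.
have case0 z : x < z -> z <= q -> t \in map (cons false) (laps n (f0 x) (f0 z)) ->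
    exists2 u, x < u < z & t = mkseq (tau s u) n.+1.
  move=> lt_xz le_zq /mapP [t' mem_t ->].
  have le_xq := le_trans (ltW lt_xz) le_zq.
  have [|||v v_in ->] := IHn _ _ _ _ _ _ mem_t.
  - by case/andP: (lorenz_itv0 x0 le_xq).
  - exact: lorenz_lt0.
  - by case/andP: (lorenz_itv0 (le_trans x0 (ltW lt_xz)) le_zq).
  have [u /andP[xu uz] <-] := lorenz_ivt0 x0 lt_xz le_zq v_in.
  have uq := lt_le_trans uz le_zq.
  exists u; first by rewrite xu.
  by rewrite mkseqS_shift shift1_itinerary_lt // {2}/itinerary /= right_of_lt.
have case1 z : z < y -> q <= z -> t \in map (cons true) (laps n (f1 z) (f1 y)) ->
    exists2 u, z < u < y & t = mkseq (tau s u) n.+1.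
  move=> lt_zy le_qz /mapP [t' mem_t ->].
  have le_qy := le_trans le_qz (ltW lt_zy).
  have [|||v v_in ->] := IHn _ _ _ _ _ _ mem_t.
  - by case/andP: (lorenz_itv1 le_qz (le_trans (ltW lt_zy) y1)).
  - exact: lorenz_lt1.
  - by case/andP: (lorenz_itv1 le_qy y1).
  have [u /andP[xu uz] <-] := lorenz_ivt1 le_qz lt_zy y1 v_in.
  have uq := le_lt_trans le_qz xu.
  exists u; first by rewrite xu.
  by rewrite mkseqS_shift shift1_itinerary_gt // {2}/itinerary /= right_of_gt.
case: leP => [le_yq|lt_qy]; first exact: case0.
case: leP => [le_qx|lt_xq]; first exact: case1.
rewrite mem_cat => /orP[/(case0 q lt_xq (lexx q))|/(case1 q lt_qy (lexx q))].
  by move=> [z /andP[xz zq] ->]; exists z; rewrite // xz (lt_trans zq).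
by move=> [z /andP[xz zq] ->]; exists z; rewrite // zq (lt_trans _ xz).
Qed.

End Lorenz.
End Itineraries.

(** * Counting prefixes, and subadditive sequences *)

Definition prefix_seqs (A : set word) (n : nat) : seq (seq bool) :=
  [seq tval t | t <- enum [pred t : n.-tuple bool |
    `[< exists2 w, A w & t = [tuple w i | i < n] >]]].

Lemma size_prefix_seqs A n : size (prefix_seqs A n) = nprefixes A n.
Proof. by rewrite size_map -cardE. Qed.

Lemma uniq_prefix_seqs A n : uniq (prefix_seqs A n).
Proof. by rewrite map_inj_uniq ?enum_uniq //; apply: val_inj. Qed.

Lemma prefix_seqsP A n u :
  reflect (exists2 w, A w & u = mkseq w n) (u \in prefix_seqs A n).
Proof.
have val_tuple (w : word) : tval [tuple w i | i < n] = mkseq w n.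
  by rewrite /= /mkseq -val_enum_ord -map_comp.
apply: (iffP mapP) => [[t]|[w Aw ->]].
  by rewrite mem_enum => /asboolP [w Aw ->] ->; exists w.
by exists [tuple w i | i < n] => //; rewrite mem_enum; apply/asboolP; exists w.
Qed.

Lemma nprefixes_le_size A n (t : seq (seq bool)) :
  (forall w, A w -> mkseq w n \in t) -> (nprefixes A n <= size t)%N.
Proof.
move=> sub; rewrite -size_prefix_seqs; apply: uniq_leq_size (uniq_prefix_seqs A n) _.
by move=> u /prefix_seqsP [w Aw ->]; apply: sub.
Qed.

Lemma size_le_nprefixes A n (t : seq (seq bool)) : uniq t ->
  (forall u, u \in t -> exists2 w, A w & u = mkseq w n) ->
  (size t <= nprefixes A n)%N.
Proof.
move=> uniq_t sub; rewrite -size_prefix_seqs; apply: uniq_leq_size uniq_t _.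
by move=> u /sub /prefix_seqsP.
Qed.

(** Cutting after [m] digits embeds the prefixes of length m + n into pairs of prefixes. *)
Lemma nprefixes_add A m n : (forall w, A w -> A (word_shift m w)) ->
  (nprefixes A (m + n) <= nprefixes A m * nprefixes A n)%N.
Proof.
move=> A_shift; rewrite -!size_prefix_seqs -(size_allpairs cat).
rewrite size_prefix_seqs; apply: nprefixes_le_size => w Aw.
apply/allpairsP; exists (mkseq w m, mkseq (word_shift m w) n); split=> /=.
- by apply/prefix_seqsP; exists w.
- by apply/prefix_seqsP; exists (word_shift m w) => //; apply: A_shift.
by rewrite /mkseq iotaD map_cat add0n -[X in iota X n]addn0 iotaDl -map_comp.
Qed.

Lemma nprefixes_gt0 (A : set word) n w : A w -> (0 < nprefixes A n)%N.
Proof.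
by move=> Aw; apply: (@size_le_nprefixes _ _ [:: mkseq w n]) => // u;
  rewrite inE => /eqP ->; exists w.
Qed.

(** Fekete's lemma: the limit is the infimum of the quotients. Some [m] nearly attains the infimum,
    and dividing [n] by [m] compares u n with a multiple of u m. *)
Lemma fekete (R : realType) (u : nat -> R) :
  (forall n, 0 <= u n) -> (forall m n, u (m + n)%N <= u m + u n) ->
  exists2 l, (fun n => n%:R^-1 * u n) @ \oo --> l &
    forall n, (0 < n)%N -> l <= n%:R^-1 * u n.
Proof.
move=> u_ge0 u_sub.
pose S := [set n%:R^-1 * u n | n in [set n | (0 < n)%N]].
have inf_S : has_inf S.
  split; first by exists (1%:R^-1 * u 1%N), 1%N.
  by exists 0 => _ [n _ <-]; rewrite mulr_ge0 // invr_ge0.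
have lb_S n : (0 < n)%N -> inf S <= n%:R^-1 * u n.
  by move=> n_gt0; apply: (ge_inf inf_S.2); exists n.
exists (inf S) => //; apply/cvgrPdist_le => e e_gt0.
have e2_gt0 : 0 < e / 2 by rewrite divr_gt0.
have [_ [m /= m_gt0 <-] lt_m] := inf_adherent e2_gt0 inf_S.
(* The sum bounds u at every remainder modulo [m]; once n >= c / (e / 2) this contribution costs at
   most e / 2 in the quotient. *)
pose c := \sum_(i < m) u i.
have u_lt r : (r < m)%N -> u r <= c.
  by move=> lt_rm; rewrite /c (bigD1 (Ordinal lt_rm)) //= lerDl sumr_ge0.
have u_mul k r : u (k * m + r)%N <= k%:R * u m + u r.
  elim: k => [|k IHk]; first by rewrite mul0n add0n mul0r add0r.
  rewrite mulSn -addnA; apply: le_trans (u_sub _ _) _.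
  by rewrite -natr1 mulrDl mul1r [leRHS]addrAC [leRHS]addrC lerD2l.
near=> n.
have n_gt0 : (0 < n)%N by near: n; exact: nbhs_infty_gt.
have n0 : 0 < n%:R :> R by rewrite ltr0n.
have m0 : 0 < m%:R :> R by rewrite ltr0n.
have c_lt : c / (e / 2) <= n%:R by near: n; exact: nbhs_infty_ger.
rewrite distrC ger0_norm ?subr_ge0 ?lb_S // lerBlDl.
rewrite mulrC ler_pdivrMr //.
have u_n : u n <= (n %/ m)%:R * u m + c.
  rewrite {1}(divn_eq n m); apply: le_trans (u_mul _ _) _.
  by rewrite lerD2l u_lt // ltn_mod.
have le_div : (n %/ m)%:R <= n%:R / m%:R :> R.
  by rewrite ler_pdivlMr // -natrM ler_nat leq_trunc_div.
have um : (n %/ m)%:R * u m <= n%:R * (inf S + e / 2).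
  apply: le_trans (_ : n%:R / m%:R * u m <= _); first by rewrite ler_wpM2r.
  by rewrite -mulrA ler_wpM2l ?(ltW n0) // ltW.
move: c_lt; rewrite ler_pdivrMr // => c_lt.
apply: le_trans u_n _; apply: le_trans (lerD um c_lt) _.
by rewrite le_eqVlt; apply/orP; left; apply/eqP; field.
Unshelve. all: by end_near. Qed.

(** * Entropy as a limit and as a lower bound *)

Section Entropy.
Variables (R : realType) (q : R) (f0 f1 : R -> R) (s : side).
Hypothesis L : lorenz q f0 f1.

Local Notation A := (address_space s q f0 f1).
Local Notation N := (nprefixes A).

Lemma address_space_shift m w : A w -> A (word_shift m w).
Proof.
move=> [x /= x01 <-]; exists (iter m (lorenz_map s q f0 f1) x).
  by move: x01; rewrite !in_itv /=; apply: lorenz_iter_itv.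
by rewrite shift_itinerary.
Qed.

Lemma address_space_neq0 : exists w, A w.
Proof. by exists (itinerary s q f0 f1 0), 0 => //=; rewrite in_itv /= lexx ler01. Qed.

Lemma nprefixes_address_gt0 n : (0 < N n)%N.
Proof. by have [w Aw] := address_space_neq0; apply: nprefixes_gt0 Aw. Qed.

Lemma nprefixes_address_mul m k : (N (m * k) <= N m ^ k)%N.
Proof.
elim: k => [|k IHk].
  rewrite muln0 expn0; apply: (@nprefixes_le_size A 0 [:: [::]]) => w _.
  by rewrite inE.
rewrite mulnS expnS; apply: leq_trans (nprefixes_add _ _) _.
  exact: address_space_shift.
by rewrite leq_mul2l IHk orbT.
Qed.

(** Logarithms of submultiplicative counts are subadditive, so the limit exists and [limn] takes no
    default value. *)
Lemma entropyP : (fun n => n%:R^-1 * ln (N n)%:R : R) @ \oo --> entropy s q f0 f1 /\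
  forall n, (0 < n)%N -> entropy s q f0 f1 <= n%:R^-1 * ln (N n)%:R.
Proof.
have [||l cvg_l le_l] := @fekete R (fun n => ln (N n)%:R).
- by move=> n; rewrite ln_ge0 // ler1n nprefixes_address_gt0.
- move=> m n; rewrite -lnM ?posrE ?ltr0n ?nprefixes_address_gt0 //.
  rewrite ler_ln ?posrE ?mulr_gt0 ?ltr0n ?nprefixes_address_gt0 // -natrM ler_nat.
  by apply: nprefixes_add; exact: address_space_shift.
have -> : entropy s q f0 f1 = l by apply: (cvg_lim (@Rhausdorff R)).
by [].
Qed.

Lemma entropy_ge a : 0 < a -> (forall n, a ^+ n <= (N n)%:R) ->
  ln a <= entropy s q f0 f1.
Proof.
move=> a_gt0 le_N; apply: limr_ge; first exact: cvgP entropyP.1.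
near=> n.
have n_gt0 : (0 < n)%N by near: n; exact: nbhs_infty_gt.
have n0 : 0 < n%:R :> R by rewrite ltr0n.
rewrite mulrC ler_pdivlMr // mulr_natr -lnXn //.
by rewrite ler_ln ?posrE ?exprn_gt0 // ltr0n nprefixes_address_gt0.
Unshelve. all: by end_near. Qed.

Lemma expR_entropy_le n : expR (entropy s q f0 f1) ^+ n <= (N n)%:R.
Proof.
case: n => [|n]; first by rewrite expr0 ler1n nprefixes_address_gt0.
rewrite -expRM_natr -[leRHS]lnK ?posrE ?ltr0n ?nprefixes_address_gt0 //.
rewrite ler_expR -ler_pdivlMr ?ltr0n // mulrC.
exact: entropyP.2.
Qed.

End Entropy.

(** * Laps against the jump of the coding at the critical point *)

Section Kneading.
Variables (R : realType) (q : R) (f0 f1 : R -> R) (a : R).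
Hypothesis L : lorenz q f0 f1.
Hypothesis a_gt1 : 1 < a.

Local Notation tau s := (itinerary s q f0 f1).
Local Notation alpha := (itinerary Lower q f0 f1 q).
Local Notation beta := (itinerary Upper q f0 f1 q).
Local Notation laps := (laps q f0 f1).
Local Notation N s n := (nprefixes (address_space s q f0 f1) n).

Let a_gt0 : 0 < a. Proof. exact: lt_trans a_gt1. Qed.

Lemma size_laps_le_nprefixes s n x y : 0 <= x -> x < y -> y <= 1 ->
  (size (laps n x y) <= N s n)%N.
Proof.
move=> x0 lt_xy y1; apply: size_le_nprefixes; first exact: uniq_laps.
move=> u /(lapsP L s x0 lt_xy y1) [z /andP[xz zy] ->].
exists (tau s z) => //; exists z => //=; rewrite in_itv /=.
by rewrite (le_trans x0 (ltW xz)) (le_trans (ltW zy) y1).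
Qed.

(* Consecutive laps of the [n]-th iterate are separated by a preimage of [q] of
   some order [j], across which the truncated coding jumps by [a ^- j] times
   the truncation at [n - j] of the kneading jump. *)
Lemma coding_trunc_laps (sg : R) :
  (forall n, sg * (coding_trunc a n beta - coding_trunc a n alpha) <= a ^- n) ->
  forall n x y, 0 <= x -> x < y -> y <= 1 ->
  sg * (coding_trunc a n (tau Lower y) - coding_trunc a n (tau Upper x))
    <= a ^- n * ((size (laps n x y))%:R - 1).
Proof.
move=> jump; elim=> [|n IHn] x y x0 lt_xy y1 /=; first by rewrite !subrr !mulr0.
pose c := coding_trunc a n.+1.
have ia_ge0 : 0 <= a^-1 by rewrite invr_ge0 ltW.
have case0 t : x < t -> t <= q ->
    sg * (c (tau Lower t) - c (tau Upper x))
      <= a ^- n.+1 * ((size (laps n (f0 x) (f0 t)))%:R - 1).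
  move=> lt_xt le_tq; have lt_xq := lt_le_trans lt_xt le_tq.
  rewrite /c /= shift1_itinerary_lower // shift1_itinerary_lt //.
  rewrite /itinerary /= (le_gtF le_tq) (lt_geF lt_xq) -!/(itinerary _ _ _ _ _).
  rewrite !mulr0 !add0r -mulrBr mulrCA exprS invfM -mulrA ler_wpM2l //.
  apply: IHn; last 1 first.
  - by case/andP: (lorenz_itv0 L (le_trans x0 (ltW lt_xt)) le_tq).
  - by case/andP: (lorenz_itv0 L x0 (ltW lt_xq)).
  - exact: (lorenz_lt0 L).
have case1 t : t < y -> q <= t ->
    sg * (c (tau Lower y) - c (tau Upper t))
      <= a ^- n.+1 * ((size (laps n (f1 t) (f1 y)))%:R - 1).
  move=> lt_ty le_qt; have lt_qy := le_lt_trans le_qt lt_ty.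
  rewrite /c /= shift1_itinerary_upper // shift1_itinerary_gt //.
  rewrite /itinerary /= le_qt lt_qy -!/(itinerary _ _ _ _ _).
  rewrite opprD addrACA subrr add0r.
  rewrite -mulrBr mulrCA exprS invfM -mulrA ler_wpM2l //.
  apply: IHn; last 1 first.
  - by case/andP: (lorenz_itv1 L (le_trans le_qt (ltW lt_ty)) y1).
  - by case/andP: (lorenz_itv1 L le_qt (le_trans (ltW lt_ty) y1)).
  - exact: (lorenz_lt1 L).
rewrite -!/(coding_trunc a n.+1 _) -/c.
case: (leP y q) => [le_yq|lt_qy]; first by rewrite size_map; apply: case0.
case: (leP q x) => [le_qx|lt_xq]; first by rewrite size_map; apply: case1.
rewrite size_cat !size_map natrD.
(* The difference is telescoped through alpha and beta. The two sub-intervals lose 1 each in the lap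
   count and the jump at [q] gives one back. *)
have := case0 q lt_xq (lexx q); have := case1 q lt_qy (lexx q); have := jump n.+1.
rewrite -/(c _); set d := a ^- n.+1; set A := c _; set B := c _; set C := c _; set D := c _.
set u := _%:R; set v := _%:R; rewrite !mulrBr !mulrDr !mulr1; lra.
Qed.

Lemma coding_trunc_ends n : coding_trunc a n (tau Lower 1) - coding_trunc a n (tau Upper 0)
  = 1 - a ^- n.
Proof.
rewrite (_ : tau Lower 1 = fun=> true); last first.
  apply/funext => k; rewrite /itinerary /=; apply/idP.
  have -> : iter k (lorenz_map Lower q f0 f1) 1 = 1.
    by elim: k => //= k ->; rewrite /lorenz_map /= (lorenz_q_lt1 L) (lorenz_fix1 L).
  exact: lorenz_q_lt1 L.
rewrite (_ : tau Upper 0 = fun=> false); last first.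
  apply/funext => k; rewrite /itinerary /=.
  have -> : iter k (lorenz_map Upper q f0 f1) 0 = 0.
    by elim: k => //= k ->; rewrite /lorenz_map /= (lt_geF (lorenz_q_gt0 L)) (lorenz_fix0 L).
  exact/lt_geF/(lorenz_q_gt0 L).
by rewrite coding_trunc1 // coding_trunc0 // subr0.
Qed.

(** Here [sg] is 1, and truncation errors keep each jump at most a^-k. Over [0, 1] the truncated
    coding rises by 1 - a^-n, which forces at least a^n laps. *)
Lemma expr_le_nprefixes s : coding a beta <= coding a alpha ->
  forall n, a ^+ n <= (N s n)%:R.
Proof.
move=> le_ba n.
have jump k : 1 * (coding_trunc a k beta - coding_trunc a k alpha) <= a ^- k.
  have /andP[_ ub] := coding_trunc_bounds a_gt1 k alpha.
  have /andP[lb _] := coding_trunc_bounds a_gt1 k beta.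
  lra.
have := coding_trunc_laps jump n (lexx 0) ltr01 (lexx 1).
rewrite coding_trunc_ends mul1r mulrBr mulr1 lerD2r.
have an_gt0 : 0 < a ^+ n by rewrite exprn_gt0.
rewrite mulrC ler_pdivlMr // mul1r => /le_trans; apply.
by rewrite ler_nat; apply: size_laps_le_nprefixes.
Qed.

(** * Consequences of having fewer than a^m prefixes for one [m] *)

Section SmallEntropy.
Variables (s0 : side) (m : nat).
Hypothesis small : (N s0 m)%:R < a ^+ m.

Lemma coding_jump_gt0 : coding a alpha < coding a beta.
Proof.
by rewrite ltNge; apply/negP => /(expr_le_nprefixes s0) /(_ m); rewrite leNgt small.
Qed.

(** Along multiples of [m], submultiplicativity bounds the density by powers of a ratio below 1. *)
Lemma small_density e : 0 < e -> exists n, a ^- n * (N s0 n)%:R < e.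
Proof.
move=> e_gt0.
pose r : R := (N s0 m)%:R / a ^+ m.
have am_gt0 : 0 < a ^+ m by rewrite exprn_gt0.
have r_ge0 : 0 <= r by rewrite divr_ge0 // ltW.
have r_lt1 : r < 1 by rewrite /r ltr_pdivrMr // mul1r.
have [k lt_k] : exists k, r ^+ k < e.
  have : (fun k => r ^+ k) @ \oo --> (0 : R) by apply: cvg_expr; rewrite ger0_norm.
  move=> /cvgrPdist_lt /(_ e e_gt0) [k _ /(_ k (leqnn k))] /=.
  by rewrite sub0r normrN => lt_k; exists k; apply: le_lt_trans lt_k; exact: ler_norm.
exists (m * k)%N; apply: le_lt_trans lt_k.
rewrite /r expr_div_n mulrC exprM ler_pM2r ?invr_gt0 ?exprn_gt0 // -natrX ler_nat.
exact: nprefixes_address_mul.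
Qed.

(** With [sg] equal to -1, a drop e > 0 of the coding would satisfy e <= a^-n N(n) for every n: the
    truncation error a^-n is exactly the 1 subtracted from the lap count. This contradicts
    [small_density]. *)
Lemma coding_homo_lt x y : 0 <= x -> x < y -> y <= 1 ->
  coding a (tau Upper x) <= coding a (tau Lower y).
Proof.
move=> x0 lt_xy y1; rewrite leNgt; apply/negP => lt_yx.
have jump k : -1 * (coding_trunc a k beta - coding_trunc a k alpha) <= a ^- k.
  have /andP[lb _] := coding_trunc_bounds a_gt1 k alpha.
  have /andP[_ ub] := coding_trunc_bounds a_gt1 k beta.
  have := coding_jump_gt0; lra.
pose e := coding a (tau Upper x) - coding a (tau Lower y).
have [|n] := @small_density e; first by rewrite subr_gt0.
apply/negP; rewrite -leNgt.
have := coding_trunc_laps jump n x0 lt_xy y1.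
have /andP[_ ub] := coding_trunc_bounds a_gt1 n (tau Upper x).
have /andP[lb _] := coding_trunc_bounds a_gt1 n (tau Lower y).
have : a ^- n * (size (laps n x y))%:R <= a ^- n * (N s0 n)%:R.
  rewrite ler_wpM2l ?invr_ge0 ?exprn_ge0 ?(ltW a_gt0) // ler_nat.
  exact: size_laps_le_nprefixes.
rewrite !mulrBr mulr1 /e; lra.
Qed.

(** Away from [q] the difference at x is a^-1 times the difference at the image of x; at [q] it is
    negative. Hence it is at most a^-n for every n. *)
Lemma coding_lower_le_upper x : 0 <= x -> x <= 1 ->
  coding a (tau Lower x) <= coding a (tau Upper x).
Proof.
move=> x0 x1; rewrite leNgt; apply/negP => lt_ul.
suff le_n n : forall x, 0 <= x <= 1 ->
    coding a (tau Lower x) - coding a (tau Upper x) <= a^-1 ^+ n.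
  have ia_lt1 : `|a^-1| < 1 by rewrite gtr0_norm ?invr_gt0 // invf_lt1.
  have /cvgrPdist_lt := cvg_expr ia_lt1.
  set d := coding a (tau Lower x) - coding a (tau Upper x).
  have d_gt0 : 0 < d by rewrite subr_gt0.
  move=> /(_ d d_gt0) [k _ /(_ k (leqnn k))] /=.
  rewrite sub0r normrN; apply/negP; rewrite -leNgt; apply: le_trans (ler_norm _).
  by apply: le_n; rewrite x0.
elim: n => [|n IHn] {x x0 x1 lt_ul} x /andP[x0 x1].
  have := coding_le1 a_gt1 (tau Lower x); have := coding_ge0 a_gt1 (tau Upper x).
  by rewrite expr0; lra.
have ia_gt0 : 0 < a^-1 by rewrite invr_gt0.
have [xq|xq|->] := ltgtP x q; last first.
- have := coding_jump_gt0; have := exprn_ge0 n.+1 (ltW ia_gt0); lra.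
- rewrite (coding_rec a_gt1 (tau Lower x)) (coding_rec a_gt1 (tau Upper x)) !shift1_itinerary_gt //.
  rewrite /itinerary /= xq (ltW xq) -!/(itinerary _ _ _ _ _).
  rewrite opprD addrACA subrr add0r -mulrBr exprS ler_pM2l //; apply: IHn.
  exact: (lorenz_itv1 L (ltW xq) x1).
- rewrite (coding_rec a_gt1 (tau Lower x)) (coding_rec a_gt1 (tau Upper x)) !shift1_itinerary_lt //.
  rewrite /itinerary /= (lt_geF xq) (le_gtF (ltW xq)) -!/(itinerary _ _ _ _ _).
  rewrite !mulr0 !add0r -mulrBr exprS ler_pM2l //; apply: IHn.
  exact: (lorenz_itv0 L x0 (ltW xq)).
Qed.

Lemma coding_homo s s' x y : 0 <= x -> x < y -> y <= 1 ->
  coding a (tau s x) <= coding a (tau s' y).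
Proof.
move=> x0 lt_xy y1; have x1 := le_trans (ltW lt_xy) y1.
have y0 := le_trans x0 (ltW lt_xy).
apply: le_trans (_ : coding a (tau Upper x) <= _).
  by case: s => //; apply: coding_lower_le_upper.
apply: le_trans (coding_homo_lt x0 lt_xy y1) _.
by case: s' => //; apply: coding_lower_le_upper.
Qed.

(** Monotonicity compares each orbit point with [q]; if the orbit returns to [q], the tail is the
    itinerary of [q] itself and equality holds. *)
Lemma coding_kneading s k :
  if tau s q k then coding a beta <= coding a (word_shift k (tau s q))
  else coding a (word_shift k (tau s q)) <= coding a alpha.
Proof.
rewrite shift_itinerary {1}/itinerary.
have q01 : 0 <= q <= 1.
  by rewrite (ltW (lorenz_q_gt0 L)) (ltW (lorenz_q_lt1 L)).
have /andP[] := lorenz_iter_itv L s k q01.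
have /andP[q0 q1] := q01.
set z := iter k _ q => z0 z1.
have [zq|zq|->] := ltgtP z q.
- by rewrite right_of_lt //; apply: coding_homo.
- by rewrite right_of_gt //; apply: coding_homo.
by case: s {z z0 z1} => /=; rewrite ?lexx // ltxx.
Qed.

End SmallEntropy.
End Kneading.

Lemma bernoulli_ineq (R : realType) (d : R) n : 0 <= d ->
  1 + n%:R * d <= (1 + d) ^+ n.
Proof.
move=> d_ge0; elim: n => [|n IHn]; first by rewrite mul0r addr0 expr0.
rewrite exprS -natr1; apply: le_trans (_ : (1 + d) * (1 + n%:R * d) <= _).
  have : 0 <= n%:R * d * d by rewrite !mulr_ge0.
  by rewrite !mulrDl !mulrDr; lra.
by rewrite ler_wpM2l // addr_ge0.
Qed.

Lemma expr_unbounded (R : realType) (a x : R) : 1 < a -> exists n, x < a ^+ n.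
Proof.
move=> a_gt1; have d_gt0 : 0 < a - 1 by rewrite subr_gt0.
have [n _ /(_ n (leqnn n)) /= lt_n] := nbhs_infty_gtr (x / (a - 1)).
exists n; rewrite ltr_pdivrMr // in lt_n; apply: lt_le_trans lt_n _.
have := bernoulli_ineq n (ltW d_gt0); rewrite (addrC 1 (a - 1)) subrK; lra.
Qed.

(** * Uniform Lorenz maps: comparison of words and growth of laps *)

Section Uniform.
Variables (R : realType) (a p : R).
Hypotheses (a_gt1 : 1 < a) (p_gt0 : 0 < p) (p_lt1 : p < 1).
Hypothesis p_adm : 1 - a^-1 <= p <= a^-1.

Local Notation u0 := (fun y : R => a * y).
Local Notation u1 := (fun y : R => a * y + 1 - a).
Local Notation U s := (lorenz_map s p u0 u1).
Local Notation mu s := (uniform_itinerary s a p).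

Let a_gt0 : 0 < a. Proof. exact: lt_trans a_gt1. Qed.
Let ap_le1 : a * p <= 1.
Proof. by case/andP: p_adm => _; rewrite -(ler_pM2l a_gt0) divff ?gt_eqF. Qed.
Let ap_ge : 0 <= a * p + 1 - a.
Proof.
by case/andP: p_adm; rewrite -(ler_pM2l a_gt0) mulrBr divff ?gt_eqF // mulr1 => H _; lra.
Qed.

Lemma uniform_map_itv s (x : R) : 0 <= x <= 1 -> 0 <= U s x <= 1.
Proof.
move=> /andP[x0 x1]; rewrite /lorenz_map.
case E: (right_of s p x).
  have := right_of_ge E; rewrite -(ler_pM2l a_gt0) => H.
  have H0 := ap_ge; have : a * x <= a by rewrite ger_pMr.
  rewrite /= => H1; apply/andP; split; lra.
have := right_of_le E; rewrite -(ler_pM2l a_gt0) => H.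
have H0 := ap_le1; have : 0 <= a * x by rewrite mulr_ge0 // ltW.
rewrite /= => H1; apply/andP; split; lra.
Qed.

Lemma uniform_iter_itv s n (x : R) : 0 <= x <= 1 -> 0 <= iter n (U s) x <= 1.
Proof. by move=> x01; elim: n => //= n; apply: uniform_map_itv. Qed.

(** While the digits agree, the orbit point and the coding of the shifted word move by the same
    affine branch of slope [a]. *)
Lemma uniform_gap s (x : R) w n : (forall k, (k < n)%N -> w k = mu s x k) ->
  iter n (U s) x - coding a (word_shift n w) = a ^+ n * (x - coding a w).
Proof.
elim: n => [|n IHn] agree; first by rewrite expr0 mul1r.
rewrite exprS -mulrA -IHn; last by move=> k lt_kn; apply: agree; apply: leqW.
rewrite coding_shift // (agree n) // iterS.
rewrite /uniform_itinerary /itinerary /lorenz_map.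
by case: ifP => _ /=; ring.
Qed.

(* A weak coding leaves the digit undecided at the critical point. *)
Definition weak_coding (w : word) : Prop := forall k,
  if w k then p <= coding a (word_shift k w) else coding a (word_shift k w) <= p.

(** At the first disagreement the coding is still below the orbit point, so the digits 1 for [w] and
    0 for the orbit would give p <= coding < orbit <= p. *)
Lemma word_lt_uniform s (x : R) w : 0 <= x <= 1 -> weak_coding w ->
  coding a w < x -> word_lt w (mu s x).
Proof.
move=> x01 weak lt_x; have d_gt0 : 0 < x - coding a w by rewrite subr_gt0.
have [eq_w|[n [agree neq]]] := eq_word_or_first_diff w (mu s x).
  (* Full agreement would stretch the gap beyond 1, although both points stay in [0, 1]. *)
  have [n lt_n] := expr_unbounded (x - coding a w)^-1 a_gt1.
  have := @uniform_gap s x w n; rewrite eq_w => /(_ (fun _ _ => erefl)).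
  rewrite -eq_w => gap.
  have := uniform_iter_itv s n x01; have := coding_ge0 a_gt1 (word_shift n w).
  move: lt_n; rewrite -(ltr_pM2r d_gt0) mulVf ?gt_eqF //; lra.
have gap := uniform_gap agree.
have : 0 < a ^+ n * (x - coding a w) by rewrite mulr_gt0 ?exprn_gt0.
rewrite -gap subr_gt0 => lt_n.
exists n; split=> //; have := weak n; move: neq.
case E: (mu s x n); case: (w n) => // _ le_n.
have := right_of_le E; move=> /(lt_le_trans lt_n) /(le_lt_trans le_n).
by rewrite ltxx.
Qed.

Lemma uniform_lt_word s (x : R) w : 0 <= x <= 1 -> weak_coding w ->
  x < coding a w -> word_lt (mu s x) w.
Proof.
move=> x01 weak lt_x; have d_gt0 : 0 < coding a w - x by rewrite subr_gt0.
have [eq_w|[n [agree neq]]] := eq_word_or_first_diff w (mu s x).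
  have [n lt_n] := expr_unbounded (coding a w - x)^-1 a_gt1.
  have := @uniform_gap s x w n; rewrite eq_w => /(_ (fun _ _ => erefl)).
  rewrite -eq_w => gap.
  have := uniform_iter_itv s n x01; have := coding_le1 a_gt1 (word_shift n w).
  move: lt_n; rewrite -(ltr_pM2r d_gt0) mulVf ?gt_eqF //.
  rewrite !mulrBr in gap *; lra.
have gap := uniform_gap agree.
have : 0 < a ^+ n * (coding a w - x) by rewrite mulr_gt0 ?exprn_gt0.
rewrite -[_ - x]opprB mulrN -gap opprB subr_gt0 => lt_n.
exists n; split; first by move=> k /agree.
have := weak n; move: neq.
case E: (mu s x n); case: (w n) => // _ le_n.
have := right_of_ge E; move=> /le_lt_trans /(_ lt_n) /lt_le_trans /(_ le_n).
by rewrite ltxx.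
Qed.

Local Notation laps := (laps p u0 u1).

Let u0_le1 (x : R) : x <= p -> a * x <= 1.
Proof. by rewrite -(ler_pM2l a_gt0) => /le_trans; apply. Qed.

Let u0_lt1 (x : R) : x < p -> a * x < 1.
Proof. by rewrite -(ltr_pM2l a_gt0) => /lt_le_trans; apply. Qed.

Let u1_ge0 (x : R) : p <= x -> 0 <= a * x + 1 - a.
Proof. by rewrite -(ler_pM2l a_gt0); have := ap_ge; lra. Qed.

Let u1_gt0 (x : R) : p < x -> 0 < a * x + 1 - a.
Proof. by rewrite -(ltr_pM2l a_gt0); have := ap_ge; lra. Qed.

Let u1_le1 (x : R) : x <= 1 -> a * x + 1 - a <= 1.
Proof. by rewrite -(ler_pM2l a_gt0); have := ap_ge; lra. Qed.

Let u1_lt1 (x : R) : x < 1 -> a * x + 1 - a < 1.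
Proof. by rewrite -(ltr_pM2l a_gt0); have := ap_ge; lra. Qed.

Let u0_ge0 (x : R) : 0 <= x -> 0 <= a * x.
Proof. by move=> x0; rewrite mulr_ge0 // ltW. Qed.

(** The radius for the image is divided by the slope, and capped by the distance to [p] when x < p;
    from x = p on, the interval lies on the right branch. *)
Lemma laps_right_germ n (x : R) : 0 <= x -> x < 1 -> exists2 d, 0 < d &
  forall y : R, x < y -> y < x + d -> y <= 1 -> size (laps n x y) = 1%N.
Proof.
elim: n x => [|n IHn] x x0 x1; first by exists 1.
have [lt_xp|le_px] := ltP x p.
  have [d d_gt0 Hd] := IHn _ (u0_ge0 x0) (u0_lt1 lt_xp).
  exists (Num.min (p - x) (d / a)); first by rewrite lt_min subr_gt0 lt_xp divr_gt0.
  move=> y lt_xy; rewrite -ltrBlDl lt_min ltrBlDr subrK => /andP[lt_yp lt_yd] y1.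
  rewrite /= (ltW lt_yp) size_map; apply: Hd; first by rewrite ltr_pM2l.
    by move: lt_yd; rewrite ltr_pdivlMr // mulrBl ![_ * a]mulrC; lra.
  exact/u0_le1/ltW.
have [d d_gt0 Hd] := IHn _ (u1_ge0 le_px) (u1_lt1 x1).
exists (d / a); first by rewrite divr_gt0.
move=> y lt_xy; rewrite -ltrBlDl => lt_yd y1.
rewrite /= leNgt (le_lt_trans le_px lt_xy) /= le_px size_map; apply: Hd.
- by rewrite ltrD2r ltrD2r ltr_pM2l.
- by move: lt_yd; rewrite ltr_pdivlMr // mulrBl ![_ * a]mulrC; lra.
- exact: u1_le1.
Qed.

Lemma laps_left_germ n (y : R) : 0 < y -> y <= 1 -> exists2 d, 0 < d &
  forall x : R, x < y -> y < x + d -> 0 <= x -> size (laps n x y) = 1%N.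
Proof.
elim: n y => [|n IHn] y y0 y1; first by exists 1.
have [le_yp|lt_py] := leP y p.
  have [||d d_gt0 Hd] := IHn (a * y); [by rewrite mulr_gt0|exact: u0_le1|].
  exists (d / a); first by rewrite divr_gt0.
  move=> x lt_xy; rewrite -ltrBlDl => lt_yd x0.
  rewrite /= le_yp size_map; apply: Hd; first by rewrite ltr_pM2l.
    by move: lt_yd; rewrite ltr_pdivlMr // mulrBl ![_ * a]mulrC; lra.
  exact: u0_ge0.
have [d d_gt0 Hd] := IHn _ (u1_gt0 lt_py) (u1_le1 y1).
exists (Num.min (y - p) (d / a)); first by rewrite lt_min subr_gt0 lt_py divr_gt0.
move=> x lt_xy; rewrite -ltrBlDl lt_min ltrD2l ltrN2 => /andP[lt_px lt_yd] x0.
rewrite /= leNgt lt_py /= (ltW lt_px) size_map; apply: Hd.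
- by rewrite ltrD2r ltrD2r ltr_pM2l.
- by move: lt_yd; rewrite ltr_pdivlMr // mulrBl ![_ * a]mulrC; lra.
- exact/u1_ge0/ltW.
Qed.

(** An interval straddling [p] splits into a left germ at a p and a right germ at a p + 1 - a, with
    one lap each; any other interval is handled by induction on its image. *)
Lemma laps_short n : exists2 d, 0 < d & forall x y : R,
  0 <= x -> x < y -> y <= 1 -> y - x < d -> (size (laps n x y) <= 2)%N.
Proof.
elim: n => [|n [d d_gt0 IHn]]; first by exists 1.
have [||dl dl_gt0 Hl] := @laps_left_germ n (a * p); [by rewrite mulr_gt0|exact: ap_le1|].
have [||dr dr_gt0 Hr] := @laps_right_germ n (a * p + 1 - a); [exact: ap_ge|exact: u1_lt1|].
exists (Num.min d (Num.min dl dr) / a); first by rewrite divr_gt0 // !lt_min d_gt0 dl_gt0.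
move=> x y x0 lt_xy y1; rewrite ltr_pdivlMr // !lt_min mulrBl ![_ * a]mulrC.
move=> /and3P[lt_d lt_dl lt_dr] /=.
have lt_a (u v : R) : u < v -> a * u < a * v by rewrite ltr_pM2l.
case: (leP y p) => [le_yp|lt_py].
  rewrite size_map; apply: IHn => //; [exact: u0_ge0|exact: lt_a|exact: u0_le1].
case: (leP p x) => [le_px|lt_xp].
  rewrite size_map; apply: IHn => //; [exact: u1_ge0| |exact: u1_le1|].
    by have := lt_a _ _ lt_xy; lra.
  lra.
have := lt_a _ _ lt_xp; have := lt_a _ _ lt_py => Hy Hx.
rewrite size_cat !size_map Hl ?Hr //.
- lra.
- lra.
- exact: u1_le1.
- lra.
- exact: u0_ge0.
Qed.

(** The affine bound is summed over the images of the laps of the k-th iterate, whose lengths add up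
    to a^k (y - x). *)
Lemma size_laps_add n k (A B : R) :
  (forall x y : R, 0 <= x -> x < y -> y <= 1 ->
    (size (laps n x y))%:R <= A + B * (y - x)) ->
  forall x y : R, 0 <= x -> x < y -> y <= 1 ->
  (size (laps (k + n) x y))%:R <=
    A * (size (laps k x y))%:R + B * a ^+ k * (y - x).
Proof.
move=> bound; elim: k => [|k IHk] x y x0 lt_xy y1.
  by rewrite add0n expr0 !mulr1; apply: bound.
have lt_a (u v : R) : u < v -> a * u < a * v by rewrite ltr_pM2l.
have case0 (t : R) : x < t -> t <= p -> (size (laps (k + n) (a * x) (a * t)))%:R <=
    A * (size (laps k (a * x) (a * t)))%:R + B * a ^+ k.+1 * (t - x).
  move=> lt_xt le_tp; rewrite exprSr mulrA -mulrA [a * (t - x)]mulrBr.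
  by rewrite -[_ * (_ - _)]/(_ * _); apply: IHk; [exact: u0_ge0|exact: lt_a|exact: u0_le1].
have case1 (t : R) : t < y -> p <= t ->
    (size (laps (k + n) (a * t + 1 - a) (a * y + 1 - a)))%:R <=
    A * (size (laps k (a * t + 1 - a) (a * y + 1 - a)))%:R + B * a ^+ k.+1 * (y - t).
  move=> lt_ty le_pt.
  have -> : B * a ^+ k.+1 * (y - t) =
      B * a ^+ k * ((a * y + 1 - a) - (a * t + 1 - a)) by rewrite exprSr; ring.
  apply: IHk; [exact: u1_ge0| |exact: u1_le1].
  by have := lt_a _ _ lt_ty; lra.
rewrite addSn /=.
case: (leP y p) => [le_yp|lt_py]; first by rewrite !size_map; apply: case0.
case: (leP p x) => [le_px|lt_xp]; first by rewrite !size_map; apply: case1.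
rewrite !size_cat !size_map !natrD.
apply: le_trans (lerD (case0 p lt_xp (lexx p)) (case1 p lt_py (lexx p))) _.
by rewrite le_eqVlt; apply/orP; left; apply/eqP; ring.
Qed.

(* With [2 <= a ^+ K], the doubling of the constant term in [size_laps_add]
   does not outgrow the linear one. *)
Lemma size_laps_growth : exists K (C : R), [/\ (0 < K)%N, 0 <= C &
  forall m, (size (laps (K * m) 0 1))%:R <= (1 + m%:R * C) * a ^+ (K * m)].
Proof.
have [K lt_K] := expr_unbounded 2 a_gt1.
have [d d_gt0 short] := laps_short K.
(* On intervals of length at least [d], the crude bound 2^K on the laps is then below C (y - x). *)
pose C : R := (2 ^ K)%:R / d.
have C_ge0 : 0 <= C by rewrite divr_ge0 // ltW.
exists K, C; split=> //.
  by case: K lt_K {short C C_ge0} => //; rewrite expr0; lra.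
have bound1 (x y : R) : 0 <= x -> x < y -> y <= 1 ->
    (size (laps K x y))%:R <= 2 + C * (y - x).
  move=> x0 lt_xy y1; have [lt_d|le_d] := ltP (y - x) d.
    apply: le_trans (_ : 2 <= _); first by rewrite ler_nat; apply: short.
    by rewrite lerDl mulr_ge0 // subr_ge0 ltW.
  apply: le_trans (_ : (2 ^ K)%:R <= _); first by rewrite ler_nat size_laps_le.
  have : (2 ^ K)%:R <= C * (y - x).
    by rewrite /C mulrAC ler_pdivlMr // ler_wpM2l.
  lra.
have aK_gt0 : 0 < a ^+ K by rewrite exprn_gt0.
have bound m (x y : R) : 0 <= x -> x < y -> y <= 1 ->
    (size (laps (K * m) x y))%:R
      <= a ^+ (K * m) + m%:R * C * a ^+ (K * m) * (y - x).
  elim: m x y => [|m IHm] x y x0 lt_xy y1.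
    by rewrite muln0 expr0 /= !mul0r addr0.
  rewrite mulnS; apply: le_trans (size_laps_add K IHm x0 lt_xy y1) _.
  rewrite exprD; set b := a ^+ (K * m); have b_ge0 : 0 <= b by rewrite exprn_ge0 ?ltW.
  apply: le_trans (_ : b * (2 + C * (y - x)) + m%:R * C * b * a ^+ K * (y - x) <= _).
    by rewrite lerD2r ler_wpM2l // bound1.
  have CE : 0 <= C * (y - x) * b.
    have yx : 0 <= y - x by rewrite subr_ge0 ltW.
    exact: mulr_ge0 (mulr_ge0 C_ge0 yx) b_ge0.
  have H1 : 0 <= b * (a ^+ K - 2) by rewrite mulr_ge0 // subr_ge0 ltW.
  have H2 : 0 <= (C * (y - x) * b) * (a ^+ K - 1) by rewrite mulr_ge0 //; lra.
  rewrite -natr1 -subr_ge0.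
  (* The slack has two parts: 2 < a^K absorbs the doubled constant term, and 1 < a^K the new linear
     term. *)
  rewrite (_ : _ - _ = b * (a ^+ K - 2) + (C * (y - x) * b) * (a ^+ K - 1)).
    exact: addr_ge0.
  by ring.
move=> m; have := bound m 0 1 (lexx 0) ltr01 (lexx 1).
by rewrite subr0 mulr1 mulrDl mul1r.
Qed.

End Uniform.

Lemma itinerary_lower_fix1 (R : realType) (q : R) (f0 f1 : R -> R) :
  q < 1 -> f1 1 = 1 -> forall n, itinerary Lower q f0 f1 1 n.
Proof.
move=> q1 fix1 n; rewrite /itinerary /= (_ : iter n _ 1 = 1) //.
by elim: n => //= n ->; rewrite /lorenz_map /= q1.
Qed.

Lemma itinerary_upper_fix0 (R : realType) (q : R) (f0 f1 : R -> R) :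
  0 < q -> f0 0 = 0 -> forall n, itinerary Upper q f0 f1 0 n = false.
Proof.
move=> q0 fix0 n; rewrite /itinerary /= (_ : iter n _ 0 = 0) ?lt_geF //.
by elim: n => //= n ->; rewrite /lorenz_map /= lt_geF.
Qed.

(** * Correctness of the bisection *)

Section Bisection.
Variables (R : realType) (q : R) (f0 f1 : R -> R).
Hypothesis L : lorenz q f0 f1.

Local Notation tau s := (itinerary s q f0 f1).
Local Notation alpha := (itinerary Lower q f0 f1 q).
Local Notation beta := (itinerary Upper q f0 f1 q).
Local Notation N s n := (nprefixes (address_space s q f0 f1) n).
Local Notation h s := (entropy s q f0 f1).
Local Notation mu s a p := (uniform_itinerary s a p).

Let q01 : 0 <= q <= 1.
Proof. by rewrite (ltW (lorenz_q_gt0 L)) (ltW (lorenz_q_lt1 L)). Qed.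

Lemma itinerary_kneading s x k : 0 <= x <= 1 ->
  if tau s x k then word_le beta (word_shift k (tau s x))
  else word_le (word_shift k (tau s x)) alpha.
Proof.
move=> x01; rewrite shift_itinerary {1}/itinerary.
have /andP[] := lorenz_iter_itv L s k x01; have /andP[q0 q1] := q01.
set z := iter k _ x => z0 z1.
have [zq|zq|->] := ltgtP z q.
- by rewrite right_of_lt //; apply: itinerary_homo.
- by rewrite right_of_gt //; apply: itinerary_homo.
by case: s {z z0 z1} => /=; rewrite ?lexx ?ltxx.
Qed.

Section Slope.
Variable a : R.
Hypothesis a_gt1 : 1 < a.

Let a_gt0 : 0 < a. Proof. exact: lt_trans a_gt1. Qed.

Section CriticalPoint.
Variable p : R.
Hypotheses (p_gt0 : 0 < p) (p_lt1 : p < 1) (p_adm : 1 - a^-1 <= p <= a^-1).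

Lemma entropy_le_ln s :
  word_le alpha (mu Lower a p p) -> word_le (mu Upper a p p) beta ->
  h s <= ln a.
Proof.
move=> le_alpha le_beta.
(* By transitivity, the kneading constraints of the Lorenz map imply those of the uniform map. *)
have lap_bound n : (N s n <= size (laps p (fun y => a * y)%R
    (fun y => a * y + 1 - a)%R n 0%R 1%R))%N.
  apply: nprefixes_le_size => _ [x /= x01 <-]; rewrite in_itv /= in x01.
  apply: kneading_word_laps.
  - by move=> u v; rewrite ltr_pM2l.
  - by move=> u v; rewrite !ltrD2r ltr_pM2l.
  - exact: ltr01.
  - move=> k; have := @itinerary_kneading s x k x01.
    case: (tau s x k) => le_k.
      exact: word_le_trans le_beta le_k.
    exact: word_le_trans le_k le_alpha.
  - by move=> k _; rewrite itinerary_upper_fix0 // mulr0.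
  - move=> k _ _; apply: itinerary_lower_fix1 => //.
    by rewrite mulr1 addrAC subrr add0r.
have [K [C [K_gt0 C_ge0 growth]]] := size_laps_growth a_gt1 p_gt0 p_lt1 p_adm.
rewrite leNgt; apply/negP => lt_h.
pose b := expR (h s).
have lt_ab : a < b by rewrite -[a]lnK ?posrE // ltr_expR.
have b_gt0 : 0 < b := expR_gt0 _.
pose r := (b / a) ^+ K.
have ba_gt1 : 1 < b / a by rewrite ltr_pdivlMr // mul1r.
pose d := r - 1.
have d_gt0 : 0 < d by rewrite subr_gt0 exprn_egt1 // -lt0n.
have r_le m : r ^+ m <= 1 + m%:R * C.
  rewrite /r -exprM expr_div_n ler_pdivrMr ?exprn_gt0 //.
  apply: le_trans (expR_entropy_le s L _) _.
  by apply: le_trans (growth m); rewrite ler_nat.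
(* Exponential growth is set against the linear bound at m = 2 j: squaring Bernoulli gives r^(2j) >=
   (1 + j d)^2, whose term j^2 d^2 exceeds 2 j C for this [j]. *)
have [j _ /(_ j (leqnn j)) /= lt_j] := nbhs_infty_gtr (2 * C / d ^+ 2).
rewrite ltr_pdivrMr ?exprn_gt0 // in lt_j.
have j_ge0 : 0 <= j%:R :> R by [].
have j_gt0 : 0 < j%:R :> R.
  rewrite lt0r j_ge0 andbT; apply/eqP => j0.
  by move: lt_j; rewrite j0 mul0r; apply/negP; rewrite -leNgt mulr_ge0.
have := r_le (j * 2)%N; rewrite exprM natrM; apply/negP; rewrite -ltNge.
have := bernoulli_ineq j (ltW d_gt0).
rewrite [1 + d]addrC subrK => le_r.
apply: lt_le_trans (_ : (1 + j%:R * d) ^+ 2 <= _); last first.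
  have jd_ge0 : 0 <= 1 + j%:R * d by rewrite addr_ge0 ?mulr_ge0 ?(ltW d_gt0).
  by rewrite lerXn2r // nnegrE // (le_trans jd_ge0).
have := ltr_pM2l j_gt0 (2 * C) (j%:R * d ^+ 2); rewrite lt_j.
have : 0 <= j%:R * d by rewrite mulr_ge0 // ltW.
rewrite (_ : (1 + j%:R * d) ^+ 2 = 1 + 2 * (j%:R * d) + j%:R * (j%:R * d ^+ 2)).
  by rewrite (_ : j%:R * 2 * C = j%:R * (2 * C)) ?mulrA //; lra.
by ring.
Qed.

End CriticalPoint.

Lemma ln_le_entropy s : (forall m, (N s m)%:R < a ^+ m -> False) -> ln a <= h s.
Proof.
move=> no_small; apply: entropy_ge => // m.
by rewrite leNgt; apply/negP => /no_small.
Qed.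

Lemma ln_le_entropy_coding s : coding a beta <= coding a alpha -> ln a <= h s.
Proof. by move=> le_ba; apply: entropy_ge => //; apply: expr_le_nprefixes. Qed.

Lemma weak_coding_kneading s0 m s p : (N s0 m)%:R < a ^+ m ->
  coding a alpha <= p <= coding a beta -> weak_coding a p (tau s q).
Proof.
move=> small /andP[le_ap le_pb] k; have := coding_kneading L a_gt1 small s k.
by case: (tau s q k) => le_k; [apply: le_trans le_k|apply: le_trans le_ap].
Qed.

End Slope.

Let alpha0 : alpha 0%N = false.
Proof. by rewrite /itinerary /= ltxx. Qed.

Let beta0 : beta 0%N.
Proof. by rewrite /itinerary /= lexx. Qed.

(** The left branch sends a^-1 to the fixed point 1. Thus when alpha is [word01] its comparison is
    an equality, and only beta remains to be tested. *)
Lemma uniform_lower_word01 (a : R) : 1 < a -> mu Lower a a^-1 a^-1 = word01.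
Proof.
move=> a_gt1; have a_gt0 : 0 < a by apply: lt_trans a_gt1.
apply: (@shift1_const true); last by rewrite /uniform_itinerary /itinerary /= ltxx.
move=> n; rewrite /uniform_itinerary shift1_itinerary_lower // divff ?gt_eqF //.
by rewrite itinerary_lower_fix1 ?invf_lt1 // mulr1 addrAC subrr add0r.
Qed.

Lemma uniform_upper_word10 (a : R) : 1 < a ->
  mu Upper a (1 - a^-1) (1 - a^-1) = word10.
Proof.
move=> a_gt1; have a_gt0 : 0 < a by apply: lt_trans a_gt1.
apply: (@shift1_const false); last by rewrite /uniform_itinerary /itinerary /= lexx.
move=> n; rewrite /uniform_itinerary shift1_itinerary_upper //.
rewrite mulrBr divff ?gt_eqF // mulr1 subrK subrr.
by rewrite itinerary_upper_fix0 ?mulr0 // subr_gt0 invf_lt1.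
Qed.

(** A successful test is a kneading comparison and bounds the entropy above; a failed one rules out
    fewer than a^m prefixes for any m, and bounds it below. *)
Lemma bisectP a1 a2 : 1 <= a1 -> a1 < a2 -> a2 <= 2 ->
  let a := (a1 + a2) / 2 in
  bisect alpha beta (a1, a2) = (a1, a) /\ (forall s, h s <= ln a) \/
  bisect alpha beta (a1, a2) = (a, a2) /\ (forall s, ln a <= h s).
Proof.
move=> a1_ge1 lt_a12 a2_le2 a.
have a_gt1 : 1 < a by rewrite /a; lra.
have a_lt2 : a < 2 by rewrite /a; lra.
have a_gt0 : 0 < a by apply: lt_trans a_gt1.
have ia_lt1 : a^-1 < 1 by rewrite invf_lt1.
have ia_gt0 : 0 < a^-1 by rewrite invr_gt0.
have ia_gt : 1 - a^-1 < a^-1.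
  have : 1 < 2 / a by rewrite ltr_pdivlMr // mul1r.
  lra.
rewrite /bisect -/a; case: asboolP => [[alphaN betaN]|not_general].
  case: ifPn => [le_t|].
    right; split=> // s; move: le_t; rewrite le_max !ge_min -!orbA.
    (* Of the four inequalities behind t1 >= t2, the first gives the lower bound, the next two force
       an excluded word, and the last contradicts a < 2. *)
    case/or4P=> [| H | H | ]; [exact: ln_le_entropy_coding| | |lra].
      by case: alphaN; apply: coding_word01_eq H.
    by case: betaN; apply: coding_word10_eq H.
  rewrite -ltNge; set t1 := Num.max _ _; set t2 := Num.min _ _ => lt_t.
  set p := (t1 + t2) / 2.
  have lt_t1p : t1 < p by rewrite /p; lra.
  have lt_pt2 : p < t2 by rewrite /p; lra.
  move: (lt_t1p) (lt_pt2); rewrite gt_max lt_min.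
  move=> /andP[lt_ap lt_p1] /andP[lt_pb lt_p2].
  have p_gt0 : 0 < p by lra.
  have p_lt1 : p < 1 by lra.
  have p_adm : 1 - a^-1 <= p <= a^-1 by rewrite !ltW.
  case: asboolP => [[lt_alpha lt_beta]|not_lt]; [left|right]; split=> // s.
    by apply: entropy_le_ln p_adm _ _ _ => //; apply: word_ltW.
  apply: ln_le_entropy => // m small; apply: not_lt.
  have p01 : 0 <= p <= 1 by rewrite !ltW.
  have p_between : coding a alpha <= p <= coding a beta by rewrite !ltW.
  split.
    apply: (word_lt_uniform a_gt1 p_adm) => //.
    exact: weak_coding_kneading small p_between.
  apply: (uniform_lt_word a_gt1 p_adm) => //.
  exact: weak_coding_kneading small p_between.
case: asboolP => [[alphaE betaN]|not_alpha].
  have p_adm : 1 - a^-1 <= a^-1 <= a^-1 by rewrite lexx ltW.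
  case: asboolP => [lt_beta|not_lt]; [left|right]; split=> // s.
    apply: entropy_le_ln p_adm _ _ _ => //; last exact: word_ltW.
    by rewrite alphaE uniform_lower_word01.
  apply: ln_le_entropy => // m small; apply: not_lt.
  (* The critical point a^-1 is the coding of alpha, so the positive jump puts it strictly below the
     coding of beta. *)
  have := coding_jump_gt0 L a_gt1 small; rewrite alphaE coding_word01 // => lt_b.
  apply: (uniform_lt_word a_gt1 p_adm) => //; first by rewrite !ltW.
  apply: weak_coding_kneading small _ => //.
  by rewrite alphaE coding_word01 // lexx ltW.
(* The last branch covers beta = 1000..., whether or not alpha = 0111.... *)
have betaE : beta = word10.
  apply: contrapT => betaN; apply: not_general; split=> // alphaE.
  exact: not_alpha.
have p_adm : 1 - a^-1 <= 1 - a^-1 <= a^-1 by rewrite lexx ltW.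
have p_gt0 : 0 < 1 - a^-1 by rewrite subr_gt0.
have p_lt1 : 1 - a^-1 < 1 by lra.
case: asboolP => [lt_alpha|not_lt]; [left|right]; split=> // s.
  apply: entropy_le_ln p_adm _ _ _ => //; first exact: word_ltW.
  by rewrite betaE uniform_upper_word10.
apply: ln_le_entropy => // m small; apply: not_lt.
have := coding_jump_gt0 L a_gt1 small; rewrite betaE coding_word10 // => lt_b.
apply: (word_lt_uniform a_gt1 p_adm) => //; first by rewrite !ltW.
apply: weak_coding_kneading small _ => //.
by rewrite betaE coding_word10 // lexx ltW.
Qed.

Lemma entropy_ge0 s : 0 <= h s.
Proof.
rewrite -ln1; apply: entropy_ge => // n.
by rewrite expr1n ler1n nprefixes_address_gt0.
Qed.

(** The entropy is at most the quotient for length 1, where there are only two prefixes. *)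
Lemma entropy_le_ln2 s : h s <= ln 2.
Proof.
have [_ /(_ 1%N isT)] := entropyP s L; rewrite invr1 mul1r => /le_trans; apply.
rewrite ler_ln ?posrE ?ltr0n ?nprefixes_address_gt0 // ler_nat.
apply: (@nprefixes_le_size _ 1 [:: [:: false]; [:: true]]) => w _.
by rewrite /mkseq /=; case: (w 0%N).
Qed.

Lemma bounds_invariant n : let: (a1, a2) := bounds R alpha beta n in
  [/\ 1 <= a1, a1 < a2, a2 <= 2, a2 - a1 = 2^-1 ^+ n &
      forall s, ln a1 <= h s <= ln a2].
Proof.
elim: n => [|n].
  rewrite /bounds /= expr0 ln1; split=> [||||s]; rewrite ?lexx ?entropy_ge0 ?entropy_le_ln2 //.
  - by rewrite ltr1n.
  - by rewrite -[X in X - _]/(1 + 1) addrK.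
rewrite /bounds iterS -/(bounds R alpha beta n).
case: (bounds R alpha beta n) => a1 a2 [a1_ge1 lt_a a2_le2 width hb].
have [[-> le_h]|[-> ge_h]] := bisectP a1_ge1 lt_a a2_le2.
  split=> [||||s]; try lra; first by rewrite [RHS]exprS; lra.
  by rewrite le_h andbT; case/andP: (hb s).
split=> [||||s]; try lra; first by rewrite [RHS]exprS; lra.
by rewrite ge_h /=; case/andP: (hb s).
Qed.

Lemma bounds_stop eps : 0 < eps -> exists n, (0 < n)%N && stop_test eps (bounds R alpha beta n).
Proof.
move=> eps_gt0; have half : `|2^-1 : R| < 1 by rewrite gtr0_norm; lra.
have e2_gt0 : 0 < eps / 2 by rewrite divr_gt0.
(* The index [k.+1] is positive, as the stopping test comes only after a pass. *)
have /cvgrPdist_lt /(_ _ e2_gt0) [k _ /(_ k.+1 (leqnSn k))] /= := cvg_expr half.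
rewrite sub0r normrN ger0_norm; last by rewrite exprn_ge0 // invr_ge0.
move=> lt_k; exists k.+1; rewrite /stop_test ltn0Sn andTb.
by have := bounds_invariant k.+1; case: (bounds R alpha beta k.+1) => a1 a2 [_ _ _ ->].
Qed.

Lemma returned_sound eps n s : 0 < eps < 1 -> stop_test eps (bounds R alpha beta n) ->
  h s \in returned eps (bounds R alpha beta n) /\
  forall y, y \in returned eps (bounds R alpha beta n) -> `|y - h s| <= eps.
Proof.
move=> /andP[e_gt0 e_lt1]; rewrite /stop_test /returned.
have := bounds_invariant n; case: (bounds R alpha beta n) => a1 a2 /=.
move=> [a1_ge1 lt_a a2_le2 _ /(_ s) /andP[lb ub]] lt_e.
set m := (a1 + a2) / 2.
have m_ge1 : 1 <= m by rewrite /m; lra.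
have lo_gt0 : 0 < m - eps / 4 by lra.
have hi_gt0 : 0 < m + eps / 4 by lra.
(* Since a2 - a1 < eps / 2, both bounds lie within eps / 4 of their midpoint. *)
have h_lb : ln (m - eps / 4) <= h s.
  by apply: le_trans lb; rewrite ler_ln ?posrE //; rewrite /m; lra.
have h_ub : h s <= ln (m + eps / 4).
  by apply: le_trans ub _; rewrite ler_ln ?posrE //; rewrite /m; lra.
split=> [|y]; rewrite in_itv /= ?h_lb // => /andP[y_lb y_ub].
have width : ln (m + eps / 4) - ln (m - eps / 4) <= eps.
  rewrite -ln_div ?posrE //.
  have -> : (m + eps / 4) / (m - eps / 4) = 1 + (eps / 2) / (m - eps / 4).
    by field; rewrite gt_eqF //; lra.
  (* By ln(1 + t) <= t it remains to see that m - eps / 4 is at least 1/2, which follows from m >= 1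
     and eps < 1. *)
  apply: le_trans (le_ln1Dx _) _.
    have : 0 < eps / 2 / (m - eps / 4) by rewrite !divr_gt0.
    lra.
  by rewrite ler_pdivrMr //; nra.
by rewrite ler_norml; apply/andP; split; lra.
Qed.

End Bisection.

Theorem mainTheorem3 (R : realType) (q : R) (f0 f1 : R -> R) (eps : R) :
  lorenz q f0 f1 -> 0 < eps < 1 ->
  let alpha := itinerary Lower q f0 f1 q in
  let beta := itinerary Upper q f0 f1 q in
  exists N : nat,
    terminates_after alpha beta eps N /\
    forall s : side,
      let h := entropy s q f0 f1 in
      [/\ forall n : nat, (n <= N)%N ->
            ln (bounds R alpha beta n).1 <= h <= ln (bounds R alpha beta n).2,
          h \in returned eps (bounds R alpha beta N) &
          forall y : R, y \in returned eps (bounds R alpha beta N) ->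
            `|y - h| <= eps].
Proof.
move=> L eps01 alpha beta; have /andP[eps_gt0 _] := eps01.
(* The least positive index passing the test is the exact number of passes. *)
have /ex_minnP [n /andP[n_gt0 stop_n] min_n] := bounds_stop L eps_gt0.
exists n; split.
  split=> // k /andP[k_gt0 lt_kn]; apply: contraTN lt_kn => stop_k.
  by rewrite -leqNgt; apply: min_n; rewrite k_gt0.
move=> s /=; have [h_in y_in] := returned_sound L s eps01 stop_n.
split=> // k _.
have := bounds_invariant L k; rewrite -/alpha -/beta.
by case: (bounds R alpha beta k) => a1 a2 [_ _ _ _ /(_ s)].
Qed.
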